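(* Let $H$ be an infinite-dimensional complex Hilbert space and let $\varphi: B(H)\to B(H)$ be an additive map whose range contains $F_2(H)$. Suppose that $$H_{\varphi(T)\varphi(S)^{*}}(\{\lambda\}) = H_{TS^{*}}(\{\lambda\}) \quad \text{for all } T,S\in B(H) \text{ and all } \lambda\in\mathbb{C}.$$ Then there exist a unitary operator $V\in B(H)$ and a nonzero scalar $\mu\in\mathbb{C}$ such that $\varphi(T)=\mu T V^{*}$ for all $T\in B(H)$.
   Context: $B(H)$ denotes the algebra of bounded linear operators on $H$, and $T^*$ the Hilbert-space adjoint of $T$. $F_2(H)$ is the set of operators in $B(H)$ of rank at most two. For $T\in B(H)$ and $x\in H$, the local resolvent set $\rho_T(x)$ is the union of all open sets $U\subseteq\mathbb{C}$ for which there is an analytic $f:U\to H$ with $(\mu I-T)f(\mu)=x$ for all $\mu\in U$; the local spectrum is $\sigma_T(x)=\mathbb{C}\setminus\rho_T(x)$. For $F\subseteq\mathbb{C}$, the local spectral subspace is $H_T(F)=\{x\in H: \sigma_T(x)\subseteq F\}$. *)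

(* Defs.v *)
(* Complex scalars: R[i] (real_closed's
   [complex R]) for an arbitrary [R : realType]; R[i]^o is the same type seen
   as a normed module over itself (this carries the topology of C). *)
From mathcomp Require Import all_boot all_order all_algebra.
From mathcomp Require Import complex.
From mathcomp Require Import all_classical all_reals all_analysis.
From Stdlib Require Import ClassicalEpsilon.
Import GRing.Theory Num.Theory numFieldNormedType.Exports.

Set Implicit Arguments.
Unset Strict Implicit.
Unset Printing Implicit Defensive.

Local Open Scope ring_scope.
Local Open Scope classical_set_scope.

Section HilbertDefs.
Variable R : realType.
Variable H : completeNormedModType R[i].

(* [inner] is an inner product (linear in the first variable, conjugate
   symmetric) inducing the norm of the complete normed space H; hence
   H is a complex Hilbert space. *)
Definition is_inner_product (inner : H -> H -> R[i]) : Prop :=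
  [/\ (forall (a : R[i]) (x y z : H),
          inner (a *: x + y) z = a * inner x z + inner y z),
      (forall x y : H, inner y x = (inner x y)^*) &
      (forall x : H, inner x x = `|x| ^+ 2)].

(* H is infinite dimensional: it contains n linearly independent vectors
   for every n. *)
Definition infinite_dimensional : Prop :=
  forall n : nat, exists f : 'I_n -> H,
    forall c : 'I_n -> R[i],
      \sum_(k < n) c k *: f k = 0 -> forall k, c k = 0.

(* T belongs to B(H): T is C-linear and bounded. *)
Definition bounded_op (T : H -> H) : Prop :=
  (forall (a : R[i]) (x y : H), T (a *: x + y) = a *: T x + T y) /\
  exists M : R[i], forall x : H, `|T x| <= M * `|x|.

(* F has rank at most two: its range lies in the span of two vectors. *)
Definition rank_le2 (F : H -> H) : Prop :=
  exists u v : H, forall x : H, exists a b : R[i], F x = a *: u + b *: v.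

Variable inner : H -> H -> R[i].

Definition is_adjoint (T S : H -> H) : Prop :=
  forall x y : H, inner (T x) y = inner x (S y).

(* The Hilbert-space adjoint T^* (chosen by description; it exists and is
   unique for T in B(H)). *)
Definition adj (T : H -> H) : H -> H :=
  epsilon (inhabits T) (is_adjoint T).

Definition unitary (V : H -> H) : Prop :=
  [/\ bounded_op V,
      (forall x, V (adj V x) = x) &
      (forall x, adj V (V x) = x)].

End HilbertDefs.

Section LocalSpectral.
Variable R : realType.
Variable H : completeNormedModType R[i].

(* local resolvent set: union of open U with an analytic (= complex
   differentiable on U) f : U -> H such that (mu I - T) f(mu) = x on U *)
Definition local_resolvent (T : H -> H) (x : H) : set R[i]^o :=
  [set z | exists U : set R[i]^o, [/\ open U, U z &
     exists f : R[i]^o -> H, forall mu : R[i]^o, U mu ->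
        derivable f mu 1 /\ mu *: f mu - T (f mu) = x]].

Definition local_spectrum (T : H -> H) (x : H) : set R[i]^o :=
  ~` local_resolvent T x.

Definition local_spectral_subspace (T : H -> H) (F : set R[i]^o) : set H :=
  [set x | local_spectrum T x `<=` F].

End LocalSpectral.

(* Main.v *)
(* Write [a (x) b] for the operator [x |-> <x, b> a].  A product [T S^*] with a
   rank-one factor has rank one, and for rank-one operators the subspaces
   [H_A({lam})] determine the eigenvalue [<u, y>] of [A = u (x) y] and, when it
   is nonzero, the line of [y].  Only two facts on local spectra are used: an
   eigenvector for [lam] lies in [H_A({lam})], and every element of
   [H_A({lam})] lies in the range of [mu - A] for all [mu <> lam].

   Taking [phi T = u (x) v] with [u = phi (a (x) b) v] shows that
   [phi (a (x) b) v] is a multiple of [a], so [phi (a (x) b) = a (x) c(a,b)].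
   Comparing eigenvalues again, [<c(a',b'), c(a,b)> = <b', b>] whenever
   [<a, a'> <> 0], which makes [c] independent of [a]: [c(a,b) = W b] with [W]
   an isometry.  One more comparison gives [phi T W = T] for every [T], and
   since every [a (x) v] is in the range of [phi] this forces [W W^* = 1], hence
   [phi T = T W^*]. *)
Require Import Defs.
From mathcomp Require Import all_boot all_order all_algebra.
From mathcomp Require Import complex.
From mathcomp Require Import all_classical all_reals all_analysis.
From mathcomp Require Import ring lra.
From Stdlib Require Import ClassicalEpsilon.
Import Order.TTheory GRing.Theory Num.Theory numFieldNormedType.Exports.
Local Open Scope ring_scope.
Local Open Scope classical_set_scope.

Local Notation Re := complex.Re.
Local Notation Im := complex.Im.

(** * Local spectral subspaces of a single point *)

Section LocalSpectrum.
Variables (R : realType) (H : completeNormedModType R[i]).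
Implicit Types (T : H -> H) (x : H).

Lemma open_neq_complex (a : R[i]^o) : open [set t : R[i]^o | t != a].
Proof.
have -> : [set t : R[i]^o | t != a] = ~` [set a].
  by apply/seteqP; split => t /= /eqP.
rewrite openC; apply: accessible_closed_set1.
exact/hausdorff_accessible/norm_hausdorff.
Qed.

Lemma derivable_scale_vec (g : R[i]^o -> R[i]^o) (mu : R[i]^o) x :
  derivable g mu 1 -> derivable (fun t => (g t : R[i]) *: x) mu 1.
Proof.
rewrite /derivable => cg.
under eq_fun do rewrite /= -scalerBl scalerA.
exact: is_cvgZr_tmp.
Qed.

(** Away from [lam], the function [t |-> (t - lam)^-1 *: x] is an analytic local resolvent. *)
Lemma eigenvector_local_spectral_subspace T x (lam : R[i]) :
  (forall a, T (a *: x) = a *: T x) -> T x = lam *: x ->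
  local_spectral_subspace T [set (lam : R[i]^o)] x.
Proof.
move=> Tx eigx mu; apply: contra_notP => /eqP mul.
exists [set t : R[i]^o | t != lam]; split => //; first exact: open_neq_complex.
exists (fun t : R[i]^o => (t - lam : R[i])^-1 *: x) => t /= tl; split.
  by apply: derivable_scale_vec; apply: derivableV; rewrite ?subr_eq0.
rewrite Tx eigx 2!scalerA -scalerBl [t * _]mulrC -mulrBr mulVf ?scale1r //.
by rewrite subr_eq0.
Qed.

Lemma local_spectral_subspace_range T x (lam mu : R[i]) :
  local_spectral_subspace T [set (lam : R[i]^o)] x -> mu != lam ->
  exists y, mu *: y - T y = x.
Proof.
move=> hx /eqP mul.
have [U [_ Umu [f hf]]] : local_resolvent T x (mu : R[i]^o).
  by apply: contra_notP mul => /hx.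
by exists (f mu); case: (hf _ Umu).
Qed.

End LocalSpectrum.

(** * Inner product algebra and Cauchy-Schwarz *)

Section Hilbert.
Set Implicit Arguments.
Unset Strict Implicit.
Variables (R : realType) (H : completeNormedModType R[i]).
Variable inner : H -> H -> R[i].
Hypothesis Hinner : is_inner_product inner.
Implicit Types (x y z : H) (t w : R[i]).

Let q x : R := Re (inner x x).

Lemma conj_complexE t : t^* = (Re t -i* Im t)%C.
Proof. by case: t. Qed.

Lemma innerC x y : inner y x = (inner x y)^*.
Proof. by case: Hinner. Qed.

Lemma innerDl x y z : inner (x + y) z = inner x z + inner y z.
Proof.
by case: Hinner => il _ _; have := il 1 x y z; rewrite scale1r mul1r.
Qed.

Lemma inner0l z : inner 0 z = 0.
Proof. by apply: (addrI (inner 0 z)); rewrite -innerDl !addr0. Qed.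

Lemma innerZl t x z : inner (t *: x) z = t * inner x z.
Proof.
by case: Hinner => il _ _; have := il t x 0 z; rewrite inner0l !addr0.
Qed.

Lemma innerNl x z : inner (- x) z = - inner x z.
Proof. by rewrite -scaleN1r innerZl mulN1r. Qed.

Lemma innerBl x y z : inner (x - y) z = inner x z - inner y z.
Proof. by rewrite innerDl innerNl. Qed.

Lemma inner0r z : inner z 0 = 0.
Proof. by rewrite innerC inner0l rmorph0. Qed.

Lemma innerDr x y z : inner z (x + y) = inner z x + inner z y.
Proof. by rewrite innerC innerDl rmorphD /= -!innerC. Qed.

Lemma innerZr t x z : inner z (t *: x) = t^* * inner z x.
Proof. by rewrite innerC innerZl rmorphM /= -innerC. Qed.

Lemma innerBr x y z : inner z (x - y) = inner z x - inner z y.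
Proof. by rewrite innerC innerBl rmorphB /= -!innerC. Qed.

Lemma inner_norm x : inner x x = `|x| ^+ 2.
Proof. by case: Hinner. Qed.

Lemma inner_eq0 x : (inner x x == 0) = (x == 0).
Proof. by rewrite inner_norm expf_eq0 /= normr_eq0. Qed.

Lemma inner_self_eq0 x : inner x x = 0 -> x = 0.
Proof. by move/eqP; rewrite inner_eq0 => /eqP. Qed.

Lemma inner_extl x y : (forall z, inner x z = inner y z) -> x = y.
Proof.
by move=> e; apply/subr0_eq/inner_self_eq0; rewrite innerBl e subrr.
Qed.

Lemma inner_extr x y : (forall z, inner z x = inner z y) -> x = y.
Proof. by move=> e; apply: inner_extl => z; rewrite innerC e -innerC. Qed.

Lemma innerE x : inner x x = (q x)%:C%C.
Proof. by rewrite RRe_real // inner_norm realX // normr_real. Qed.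

Lemma sqnorm_ge0 x : 0 <= q x.
Proof. by rewrite -ler0c -innerE inner_norm exprn_ge0. Qed.

Lemma sqnormD x z t :
  q (x + t *: z) = q x + 2 * Re (t * inner z x) + Re (t * t^*) * q z.
Proof.
rewrite /q !innerDl !innerDr !innerZl !innerZr [inner x z]innerC (innerE z).
rewrite !conj_complexE; move: (inner x x) (inner z x) => [a1 a2] [b1 b2].
case: t => t1 t2; rewrite /q /=; ring.
Qed.

Lemma sqmod_ge0 w : 0 <= Re (w * w^*).
Proof. by rewrite conj_complexE; case: w => a b /=; nra. Qed.

Lemma sqmod_eq0 w : Re (w * w^*) <= 0 -> w = 0.
Proof.
rewrite conj_complexE; case: w => a b /= h.
have a0 : a = 0 by nra.
have b0 : b = 0 by nra.
by rewrite a0 b0.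
Qed.

Lemma sqmodD t w :
  Re ((t + w) * (t + w)^*) <= 2 * (Re (t * t^*) + Re (w * w^*)).
Proof.
rewrite !conj_complexE; case: t w => t1 t2 [w1 w2] /=.
by have := sqr_ge0 (t1 - w1); have := sqr_ge0 (t2 - w2); nra.
Qed.

(* Minimise the quadratic over the line [t = - s w^*], [s] real. *)
Lemma quadratic_discr (e N : R) w : 0 <= N ->
  (forall t, - e <= 2 * Re (t * w) + Re (t * t^*) * N) ->
  Re (w * w^*) <= e * N.
Proof.
move=> N0 h; set W := Re _.
have W0 : 0 <= W by exact: sqmod_ge0.
have hs (s : R) : - e <= - 2 * s * W + s ^+ 2 * W * N.
  have := h (- (s%:C%C * w^*)); rewrite /W !conj_complexE.
  case: w {h W W0} => a b /= h; apply: le_trans h _.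
  by rewrite le_eqVlt; apply/orP; left; apply/eqP; ring.
have e0 : 0 <= e by have := hs 0; nra.
have [N0'|Nne] := eqVneq N 0.
  rewrite N0' mulr0 leNgt; apply/negP => W0'.
  (* Without the quadratic term the bound is affine in [s]; this [s] turns it into
     [- e <= - 2 * (e + 1)]. *)
  have := hs ((e + 1) / W); rewrite N0' mulr0 addr0 -!mulrA mulVf ?gt_eqF //.
  lra.
have Np : 0 < N by rewrite lt_def Nne.
(* The quadratic in [s] attains its minimum at [N^-1]. *)
have := hs N^-1.
have -> : - 2 * N^-1 * W + N^-1 ^+ 2 * W * N = - (W / N) by field.
by rewrite lerN2 ler_pdivrMr.
Qed.

Lemma cauchy_schwarz x z : Re (inner z x * (inner z x)^*) <= q x * q z.
Proof.
apply: quadratic_discr => [|t]; first exact: sqnorm_ge0.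
by have := sqnorm_ge0 (x + t *: z); rewrite sqnormD; lra.
Qed.

(** * Completeness, Riesz representation and adjoints *)

Lemma norm_lt_sqnorm x (e : R) : 0 < e -> (`|x| < e%:C%C) = (q x < e ^+ 2).
Proof.
move=> e0; rewrite -ltcR -innerE inner_norm rmorphXn /=.
by rewrite ltr_pXn2r ?nnegrE ?ler0c // ltW.
Qed.

Lemma near_sqnorm_lt (xs : nat -> H) x (e : R) : 0 < e ->
  xs n @[n --> \oo] --> x -> \forall n \near \oo, q (x - xs n) < e.
Proof.
move=> e0 /cvgr_dist_lt /(_ (Num.sqrt e)%:C%C).
rewrite ltcR sqrtr_gt0 => /(_ e0).
apply: filterS => n; rewrite norm_lt_sqnorm ?sqrtr_gt0 // sqr_sqrtr //.
exact: ltW.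
Qed.

Lemma sqnorm_cauchy_cvg (xs : nat -> H) (c : R) :
  (forall n m, (n <= m)%N -> q (xs n - xs m) <= c / n.+1%:R) ->
  cvg (xs n @[n --> \oo]).
Proof.
move=> h; apply/cauchy_cvgP/cauchy_exP => e e0.
have er : e = (Re e)%:C%C by rewrite RRe_real // gtr0_real.
have e0' : 0 < Re e by rewrite -ltcR -er.
have d0 : 0 < Re e ^+ 2 / (`|c| + 1) by rewrite divr_gt0 ?exprn_gt0 ?ltr_wpDl.
have [n _ hn] := near_infty_natSinv_lt (PosNum d0).
exists (xs n); exists n => // m /= nm.
rewrite -ball_normE /= er norm_lt_sqnorm //.
apply: le_lt_trans (h _ _ nm) _.
have := hn n (leqnn n); rewrite /= ltr_pdivlMr ?ltr_wpDl // => {}hn.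
apply: le_lt_trans hn; rewrite mulrC ler_wpM2l ?invr_ge0 //.
by apply: le_trans (ler_norm _) _; rewrite lerDl.
Qed.

(* The representing vector minimises [q x - 2 Re (f x)]. *)
Lemma riesz (f : H -> R[i]) (m : R) :
  (forall a x y, f (a *: x + y) = a * f x + f y) ->
  (forall x, Re (f x * (f x)^*) <= m * q x) ->
  exists y, forall x, f x = inner x y.
Proof.
move=> lin bnd.
have fD x z t : f (x + t *: z) = f x + t * f z by rewrite addrC lin addrC.
pose J x := q x - 2 * Re (f x).
have JD x z t : J (x + t *: z) =
    J x + 2 * Re (t * (inner z x - f z)) + Re (t * t^*) * q z.
  rewrite /J sqnormD fD mulrBr.
  move: (f x) (t * f z) (t * inner z x) => [? ?] [? ?] [? ?] /=; ring.
pose E := [set J x | x in setT].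
(* From [Re (f x) ^+ 2 <= |m| * q x] and the arithmetic-geometric mean inequality. *)
have J0 x : - `|m| <= J x.
  have h1 := bnd x; have h2 := sqnorm_ge0 x; have h3 := ler_norm m.
  have h4 := normr_ge0 m.
  have h5 : Re (f x) ^+ 2 <= `|m| * q x.
    apply: le_trans (_ : m * q x <= _); last exact: ler_wpM2r.
    apply: le_trans h1; rewrite conj_complexE; case: (f x) => ? ? /=; nra.
  rewrite /J leNgt; apply/negP => h6.
  have : (q x + `|m|) ^+ 2 < (2 * Re (f x)) ^+ 2.
    by rewrite ltr_pXn2r ?nnegrE //; lra.
  by have := sqr_ge0 (q x - `|m|); lra.
have Einf : has_inf E.
  by split; [exists (J 0), 0 | exists (- `|m|) => _ [x _ <-]].
have infJ x : inf E <= J x by apply: ge_inf => //; [case: Einf | exists x].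
have /choice[xs hxs] (n : nat) : exists x, J x < inf E + n.+1%:R^-1.
  have : 0 < n.+1%:R^-1 :> R by rewrite invr_gt0.
  by move=> /inf_adherent /(_ Einf)[_ [x _ <-] h]; exists x.
have cxs : cvg (xs n @[n --> \oo]).
  apply: (@sqnorm_cauchy_cvg _ 4) => n k nk.
  (* Parallelogram law: [J] at the midpoint is at least [inf E], so [q (xs n - xs k) <= 2 * (J (xs
     n) + J (xs k)) - 4 * inf E], whence the constant 4. *)
  have h1 := infJ (xs k + 2^-1 *: (xs n - xs k)).
  have h2 : J (xs n) = J (xs k + 1 *: (xs n - xs k)) by rewrite scale1r subrKC.
  have h3 := hxs n; have h4 := hxs k.
  have h5 : k.+1%:R^-1 <= n.+1%:R^-1 :> R by rewrite lef_pV2 ?posrE // ler_nat.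
  move: h1 h2; rewrite !JD.
  have -> : 2^-1 = (2^-1)%:C%C :> R[i] by rewrite fmorphV /= rmorph_nat.
  rewrite !conj_complexE.
  move: (inner _ _ - f _) (J (xs n)) (J (xs k)) (q _) n.+1%:R^-1 k.+1%:R^-1
    h3 h4 h5.
  by case=> w1 w2 Jn Jk qnk n1 k1 /=; lra.
have [x xsx] : exists x, xs n @[n --> \oo] --> x.
  by exists (lim (xs n @[n --> \oo])).
exists x => z; apply/esym/subr0_eq/sqmod_eq0/ler_addgt0Pl => e e0.
rewrite addr0.
have q0 := sqnorm_ge0 z.
(* The final estimate is [2 * (q (x - xs n) * q z + n.+1%:R^-1 * q z)]; adding 1 covers
   [q z = 0]. *)
have d0 : 0 < e / (4 * q z + 1) by rewrite divr_gt0 // ltr_wpDl // mulr_ge0.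
have [n [h1 h2]] : exists n, q (x - xs n) < e / (4 * q z + 1) /\
    n.+1%:R^-1 < e / (4 * q z + 1).
  by near \oo => n; exists n; split; near: n;
    [exact: near_sqnorm_lt | exact: near_infty_natSinv_lt (PosNum d0)].
have -> : inner z x - f z = inner z (x - xs n) + (inner z (xs n) - f z).
  by rewrite innerBr; ring.
apply: le_trans (sqmodD _ _) _.
have h3 := cauchy_schwarz (x - xs n) z.
(* As [xs n] minimises [J] up to [n.+1%:R^-1], the first variation of [J] there is small. *)
have h4 : Re ((inner z (xs n) - f z) * (inner z (xs n) - f z)^*) <=
    n.+1%:R^-1 * q z.
  apply: quadratic_discr => // t; have := infJ (xs n + t *: z).
  by rewrite JD; have := hxs n; move: n.+1%:R^-1 => r; lra.
rewrite ltr_pdivlMr ?ltr_wpDl ?mulr_ge0 // in h1.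
rewrite ltr_pdivlMr ?ltr_wpDl ?mulr_ge0 // in h2.
have h5 := sqnorm_ge0 (x - xs n).
have h6 : 0 <= n.+1%:R^-1 :> R by rewrite invr_ge0.
by move: n.+1%:R^-1 h2 h4 h6 => r h2 h4 h6; lra.
Unshelve. all: by end_near. Qed.

(** Riesz applied to [x |-> inner (T x) y] provides an adjoint, so the choice in [adj] is a genuine
    one. *)
Lemma adjP (T : H -> H) : bounded_op T -> is_adjoint inner T (adj inner T).
Proof.
case=> lin [M bnd]; apply: epsilon_spec.
suff /choice[S hS] : forall y, exists z, forall x, inner (T x) y = inner x z.
  by exists S => x y.
move=> y; apply: (@riesz _ (Re M ^+ 2 * q y)) => [a x z|x].
  by rewrite lin innerDl innerZl.
apply: le_trans (cauchy_schwarz _ _) _.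
rewrite mulrC -mulrA [q y * _]mulrC mulrA ler_wpM2r ?sqnorm_ge0 //.
have qE z : q z = Re `|z| ^+ 2.
  by rewrite /q inner_norm -(RRe_real (normr_real z)) -rmorphXn.
rewrite !qE -exprMn.
have := bnd x; rewrite -{1}(RRe_real (normr_real (T x))).
rewrite -{1}(RRe_real (normr_real x)).
rewrite lecE => /andP[_]; case: M {bnd} => M1 M2 /=; rewrite mulr0 subr0 => h.
by rewrite lerXn2r ?nnegrE ?(le_trans _ h) // -ler0c RRe_real ?normr_real.
Qed.

(** * Rank-one operators and their local spectral subspaces *)

Implicit Types (T : H -> H) (a b c u v : H).

Definition rank_one a b : H -> H := fun x => inner x b *: a.

Lemma norm_inner_le x y : `|inner x y| <= `|x| * `|y|.
Proof.
rewrite -(@ler_pXn2r _ 2) ?nnegrE ?mulr_ge0 // exprMn -!inner_norm.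
rewrite !innerE -rmorphM /= normCK -(@RRe_real _ (_ * _^*)); last first.
  by rewrite -normCK realX // normr_real.
by rewrite lecR [leRHS]mulrC; exact: cauchy_schwarz.
Qed.

Lemma bounded_op_rank_one a b : bounded_op (rank_one a b).
Proof.
split=> [k x y|]; first by rewrite /rank_one innerDl innerZl scalerDl scalerA.
exists (`|b| * `|a|) => x; rewrite normrZ mulrAC ler_wpM2r // mulrC.
exact: norm_inner_le.
Qed.

Lemma rank_le2_rank_one a b : rank_le2 (rank_one a b).
Proof.
by exists a, 0 => x; exists (inner x b), 0; rewrite scaler0 addr0.
Qed.

Lemma bounded_opZ T k x : bounded_op T -> T (k *: x) = k *: T x.
Proof.
case=> lin _; have T0 : T 0 = 0.
  by apply: (addrI (T 0)); have := lin 1 0 0; rewrite !scale1r !addr0 => <-.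
by have := lin k x 0; rewrite T0 !addr0.
Qed.

Lemma inner_adjl T x y : bounded_op T ->
  inner (adj inner T x) y = inner x (T y).
Proof. by move=> bT; rewrite [LHS]innerC -(adjP bT) -innerC. Qed.

Lemma adj_rank_one a b : adj inner (rank_one a b) = rank_one b a.
Proof.
apply/funext => x; apply: inner_extl => y.
rewrite inner_adjl; last exact: bounded_op_rank_one.
by rewrite /rank_one innerZr innerZl mulrC -innerC mulrC.
Qed.

Lemma comp_rank_one T a b : bounded_op T ->
  T \o rank_one a b = rank_one (T a) b.
Proof. by move=> bT; apply/funext => x; rewrite /= bounded_opZ. Qed.

Lemma rank_one_comp_adj T a b : bounded_op T ->
  rank_one a b \o adj inner T = rank_one a (T b).
Proof. by move=> bT; apply/funext => x; rewrite /rank_one /= inner_adjl. Qed.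

Lemma rank_oneI a b c : a != 0 -> rank_one a b = rank_one a c -> b = c.
Proof.
move=> a0 e; apply: inner_extr => z.
have := congr1 (@^~ z) e; rewrite /rank_one => /eqP.
by rewrite -subr_eq0 -scalerBl scaler_eq0 (negbTE a0) orbF subr_eq0 => /eqP.
Qed.

Lemma rank_one_local_spectral u y u' y' :
  (forall lam : R[i],
    local_spectral_subspace (rank_one u y) [set (lam : R[i]^o)] =
    local_spectral_subspace (rank_one u' y') [set (lam : R[i]^o)]) ->
  inner u y != 0 ->
  inner u' y' = inner u y /\ exists k, y' = k *: y.
Proof.
move=> heq uy0.
have Z a b k x : rank_one a b (k *: x) = k *: rank_one a b x.
  by rewrite bounded_opZ //; exact: bounded_op_rank_one.
have range_perp a b z x : inner a b *: x - rank_one a b x = z -> inner z b = 0.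
  by move=> <-; rewrite innerBl !innerZl mulrC subrr.
(* Being an eigenvector for a nonzero value, [u] lies in the range of [0 - rank_one u' y']. *)
have [k uE] : exists k, u = k *: u'.
  have : local_spectral_subspace (rank_one u' y') [set (inner u y : R[i]^o)] u.
    by rewrite -heq; apply: eigenvector_local_spectral_subspace.
  move/local_spectral_subspace_range => /(_ 0); rewrite eq_sym => /(_ uy0)[w].
  by rewrite scale0r sub0r -scaleNr => <-; exists (- inner w y').
(* Otherwise [u], also an eigenvector of [rank_one u' y'], would lie in the range of
   [inner u y - rank_one u y], which is orthogonal to [y]. *)
have e : inner u' y' = inner u y.
  apply/eqP/negPn/negP => ne; move/eqP: uy0; apply.
  have : local_spectral_subspace (rank_one u y) [set (inner u' y' : R[i]^o)] u.
    rewrite heq; apply: eigenvector_local_spectral_subspace => //.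
    by rewrite uE Z /rank_one scalerA mulrC -scalerA.
  move/local_spectral_subspace_range => /(_ (inner u y)); rewrite eq_sym.
  by move=> /(_ ne)[w /range_perp].
split=> //.
(* Kernel vectors of the first operator lie in the range of [inner u' y' - rank_one u' y'],
   orthogonal to [y']. *)
have perp z : inner z y = 0 -> inner z y' = 0.
  move=> zy.
  have : local_spectral_subspace (rank_one u' y') [set (0 : R[i]^o)] z.
    rewrite -heq; apply: eigenvector_local_spectral_subspace => //.
    by rewrite /rank_one zy !scale0r.
  move/local_spectral_subspace_range => /(_ (inner u' y')).
  by rewrite e => /(_ uy0)[w]; rewrite -e => /range_perp.
have yy0 : inner y y != 0.
  by apply: contra uy0; rewrite inner_eq0 => /eqP ->; rewrite inner0r.
(* Orthogonal projection of [y'] on [y]: the remainder is orthogonal to [y], hence to [y'], hence to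
   itself. *)
exists (inner y' y / inner y y).
apply/subr0_eq/inner_self_eq0; set z := _ - _.
have zy : inner z y = 0 by rewrite innerBl innerZl divfK // subrr.
by rewrite {2}/z innerBr innerZr zy mulr0 perp // subr0.
Qed.

(** If either side is nonzero the preceding lemma applies, with the operators exchanged if
    needed. *)
Lemma rank_one_local_spectral_eigenvalue u y u' y' :
  (forall lam : R[i],
    local_spectral_subspace (rank_one u y) [set (lam : R[i]^o)] =
    local_spectral_subspace (rank_one u' y') [set (lam : R[i]^o)]) ->
  inner u y = inner u' y'.
Proof.
move=> heq.
have [uy0|/(rank_one_local_spectral heq)[->//]] := eqVneq (inner u y) 0.
have [->//|/rank_one_local_spectral h] := eqVneq (inner u' y') 0.
by case: (h u y) => // lam.
Qed.

(** Linearity comes for free: the squared norm of [W (k *: x + y) - (k *: W x + W y)] expands into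
    inner products that [W] preserves. *)
Lemma bounded_op_isometry (W : H -> H) :
  (forall x y, inner (W x) (W y) = inner x y) -> bounded_op W.
Proof.
move=> isoW; split=> [k x y|].
  apply/subr0_eq/inner_self_eq0; rewrite !(innerBl, innerBr).
  rewrite !(innerDl, innerDr, innerZl, innerZr) !isoW.
  by rewrite !(innerDl, innerDr, innerZl, innerZr); ring.
exists 1 => x; rewrite mul1r -(@ler_pXn2r _ 2) ?nnegrE //.
by rewrite -!inner_norm isoW.
Qed.

Lemma infinite_dimensional_neq0 : infinite_dimensional H -> exists x : H, x != 0.
Proof.
move=> /(_ 1)[f hf]; exists (f ord0); apply/eqP => f0; have := hf (fun=> 1).
by rewrite big_ord1 scale1r => /(_ f0 ord0) /eqP; rewrite oner_eq0.
Qed.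

(** * Maps preserving the local spectral subspaces *)

Section Preserver.
Hypothesis Hinf : infinite_dimensional H.
Variable phi : (H -> H) -> (H -> H).
Hypothesis phi_B : forall T, bounded_op T -> bounded_op (phi T).
Hypothesis phi_range : forall F, bounded_op F -> rank_le2 F ->
  exists T, bounded_op T /\ phi T = F.
Hypothesis Hloc : forall T S, bounded_op T -> bounded_op S -> forall lam : R[i],
  local_spectral_subspace (phi T \o adj inner (phi S)) [set (lam : R[i]^o)]
  = local_spectral_subspace (T \o adj inner S) [set (lam : R[i]^o)].

(* Test [phi (a (x) b)] against a [T] with [phi T = u (x) v], where
   [u = phi (a (x) b) v]: both products are then of rank one. *)
Lemma phi_rank_one_apply a b v : exists k, phi (rank_one a b) v = k *: a.
Proof.
have bS := bounded_op_rank_one a b.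
set u := phi _ v; have [->|u0] := eqVneq u 0.
  by exists 0; rewrite scale0r.
have [T [bT phiT]] :=
  phi_range (bounded_op_rank_one u v) (rank_le2_rank_one u v).
have heq := Hloc bT bS.
rewrite phiT (rank_one_comp_adj _ _ (phi_B bS)) adj_rank_one in heq.
rewrite comp_rank_one // -/u in heq.
have uu0 : inner u u != 0 by rewrite inner_eq0.
have [e [k aE]] := rank_one_local_spectral heq uu0.
have k0 : k != 0.
  by apply: contra uu0 => /eqP k0; rewrite -e aE k0 scale0r inner0r.
by exists k^-1; rewrite aE scalerA mulVf ?scale1r.
Qed.

Lemma phi_rank_one a b : exists c, a != 0 -> phi (rank_one a b) = rank_one a c.
Proof.
set S := rank_one a b.
have bS : bounded_op (phi S) by exact/phi_B/bounded_op_rank_one.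
(* Pairing [phi S v = k *: a] with [a] gives [k], and the adjoint makes it an inner product with
   [v]. *)
exists ((inner a a)^-1 *: adj inner (phi S) a) => a0.
apply/funext => v; have [k kE] := phi_rank_one_apply a b v.
rewrite /rank_one innerZr -adjP // kE innerZl fmorphV /= -innerC.
by rewrite mulrCA mulVf ?mulr1 // inner_eq0.
Qed.

Lemma phi_right_factor : exists W : H -> H,
  (forall x y, inner (W x) (W y) = inner x y) /\
  (forall a b, a != 0 -> phi (rank_one a b) = rank_one a (W b)).
Proof.
have /choice[c0 hc0] (ab : H * H) : exists c, ab.1 != 0 ->
    phi (rank_one ab.1 ab.2) = rank_one ab.1 c.
  exact: phi_rank_one.
pose c a b := c0 (a, b).
have hc a b : a != 0 -> phi (rank_one a b) = rank_one a (c a b).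
  exact: (hc0 (a, b)).
(* The product for [rank_one a b] and [rank_one a' b'] has eigenvalue [inner b' b * inner a a']; the
   common factor cancels. *)
have innerc a a' b b' : inner a a' != 0 ->
    inner (c a' b') (c a b) = inner b' b.
  move=> aa'.
  have a0 : a != 0 by apply: contra aa' => /eqP ->; rewrite inner0l.
  have a'0 : a' != 0 by apply: contra aa' => /eqP ->; rewrite inner0r.
  have heq := Hloc (bounded_op_rank_one a b) (bounded_op_rank_one a' b').
  rewrite !hc // !adj_rank_one !comp_rank_one in heq;
    do 2?[exact: bounded_op_rank_one].
  have := rank_one_local_spectral_eigenvalue heq.
  by rewrite /rank_one !innerZl => /(mulIf aa').
have c_nonorth a a' b : inner a a' != 0 -> c a b = c a' b.
  move=> aa'; have a0 : inner a a != 0.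
    by rewrite inner_eq0; apply: contra aa' => /eqP ->; rewrite inner0l.
  have a'0 : inner a' a' != 0.
    by rewrite inner_eq0; apply: contra aa' => /eqP ->; rewrite inner0r.
  have a'a : inner a' a != 0 by rewrite innerC conjC_eq0.
  by apply/subr0_eq/inner_self_eq0; rewrite innerBl !innerBr !innerc // !subrr.
have c_indep a a' b : a != 0 -> a' != 0 -> c a b = c a' b.
  rewrite -!inner_eq0 => a0 a'0.
  have [aa'|/c_nonorth //] := eqVneq (inner a a') 0.
  (* For orthogonal [a] and [a'], the sum is orthogonal to neither. *)
  transitivity (c (a + a') b); apply: c_nonorth.
    by rewrite innerDr aa' addr0.
  by rewrite innerDl aa' add0r.
have [a0 a00] := infinite_dimensional_neq0 Hinf.
exists (c a0); split=> [x y|a b a_neq0]; first by rewrite innerc // inner_eq0.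
by rewrite hc // (c_indep a a0).
Qed.

Lemma phi_right_multiplication : exists V : H -> H,
  unitary inner V /\
  forall T, bounded_op T -> phi T = (fun x => T (adj inner V x)).
Proof.
have [W [isoW phiW]] := phi_right_factor.
have bW := bounded_op_isometry isoW.
(* Testing against [rank_one a x] compares the inner products of both sides with [a]. *)
have phiK T x : bounded_op T -> phi T (W x) = T x.
  move=> bT; apply: inner_extl => a.
  have [->|a0] := eqVneq a 0; first by rewrite !inner0r.
  apply: rank_one_local_spectral_eigenvalue => lam.
  have := Hloc bT (bounded_op_rank_one a x) lam.
  by rewrite phiW // !adj_rank_one !comp_rank_one //; exact: phi_B.
have WK x : adj inner W (W x) = x.
  by apply: inner_extl => z; rewrite inner_adjl.
have KW v : W (adj inner W v) = v.
  have [a a0] := infinite_dimensional_neq0 Hinf.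
  have [T [bT phiT]] :=
    phi_range (bounded_op_rank_one a v) (rank_le2_rank_one a v).
  (* Then [phi T] is both [rank_one a v] and [rank_one a (W (adj inner W v))]. *)
  have TE : T = rank_one a (adj inner W v).
    by apply/funext => x; rewrite -phiK // phiT /rank_one adjP.
  by move: phiT; rewrite TE phiW // => /(rank_oneI a0).
exists W; split=> [|T bT]; first by split.
by apply/funext => x; rewrite -{1}(KW x) phiK.
Qed.

End Preserver.

End Hilbert.

Theorem theorem3p1 (R : realType) (H : completeNormedModType R[i])
  (inner : H -> H -> R[i]) (Hinner : is_inner_product inner)
  (Hinf : infinite_dimensional H)
  (phi : (H -> H) -> (H -> H))
  (phi_B : forall T, bounded_op T -> bounded_op (phi T))
  (phi_add : forall T S, bounded_op T -> bounded_op S ->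
     phi (fun x => T x + S x) = (fun x => phi T x + phi S x))
  (phi_range : forall F, bounded_op F -> rank_le2 F ->
     exists T, bounded_op T /\ phi T = F)
  (Hloc : forall T S, bounded_op T -> bounded_op S -> forall lam : R[i],
     local_spectral_subspace (phi T \o adj inner (phi S)) [set (lam : R[i]^o)]
     = local_spectral_subspace (T \o adj inner S) [set (lam : R[i]^o)]) :
  exists (V : H -> H) (mu : R[i]),
    [/\ unitary inner V, mu != 0 &
        forall T, bounded_op T -> phi T = (fun x => mu *: T (adj inner V x))].
Proof.
have [V [uV phiV]] :=
  phi_right_multiplication Hinner Hinf phi_B phi_range Hloc.
(* The isometry [W] is already normalised, so the scalar is 1. *)
exists V, 1; split=> // T /phiV ->.
by apply/funext => x; rewrite scale1r.
Qed.
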